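(* If $\#\Delta<\infty$ then the imaginary cone $Q$ of $W$ satisfies $$Q=\{\,wv\mid w\in W\text{ and } v\in P\text{ such that }(v,a)\le 0\text{ for all }a\in\Phi^+\,\}.$$
   Context: Coxeter datum. Let $V$ be a real vector space with a symmetric bilinear form $(\,,\,)$. For $A\subseteq V$, $\mathrm{PLC}(A)$ is the set of all (finite) sums $\sum_{a\in A}\lambda_a a$ with all $\lambda_a\ge 0$ and some $\lambda_{a'}>0$. A subset $\Delta\subseteq V$ is a root basis if (C1) $(a,a)=1$ for all $a\in\Delta$, and for distinct $a,b\in\Delta$ either $(a,b)=-\cos(\pi/m_{ab})$ for an integer $m_{ab}=m_{ba}\ge 2$, or $(a,b)\le -1$ (then $m_{ab}=m_{ba}=\infty$); (C2) $0\notin\mathrm{PLC}(\Delta)$. ($\Delta$ may be linearly dependent.) Fix such a Coxeter datum $(V,\Delta,(\,,\,))$. Let $(W,S)$, $S=\{r_a\mid a\in\Delta\}$, be the Coxeter system in which the $r_a$ are involutions and $r_ar_b$ has order $m_{ab}$; $W$ acts on $V$ (faithfully, preserving the form) by $r_a x=x-2(x,a)a$. Let $\Phi=\{wa\mid w\in W,a\in\Delta\}$ and $\Phi^+=\Phi\cap\mathrm{PLC}(\Delta)$ (positive roots). Cones. Let $X=\mathrm{span}(\Delta)$ and $X^*=\mathrm{Hom}(X,\mathbb R)$, with $W$ acting on $X^*$ by $(wf)(v)=f(w^{-1}v)$. Let $P=\mathrm{PLC}(\Delta)\cup\{0\}$ and $P^*=\{f\in X^*\mid f(v)\ge 0\text{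 for all }v\in P\}$. The Tits cone is $U=\bigcup_{w\in W}wP^*\subseteq X^*$, and its dual is $U^*=\{v\in X\mid f(v)\ge 0\text{ for all }f\in U\}$. The imaginary cone of $W$ is $Q=\{v\in U^*\mid (v,a)\le 0\text{ for all but finitely many }a\in\Phi^+\}$. *)

(* Defs.v *)
From HB Require Import structures.
From mathcomp Require Import all_boot all_order all_algebra.
From mathcomp Require Import all_classical all_reals.
From mathcomp Require Import trigo.

Set Implicit Arguments.
Unset Strict Implicit.
Unset Printing Implicit Defensive.
Import Order.TTheory GRing.Theory Num.Theory.

Local Open Scope classical_set_scope.
Local Open Scope ring_scope.

Section LinearCombinations.
Context {R : realType} {V : lmodType R}.
Implicit Type A : set V.

(* The finiteness clause is needed: \sum_(a \in A) is 0 by convention when the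
   summand has infinite support. *)
Definition PLC A : set V :=
  [set v | exists lam : V -> R,
    [/\ finite_set (A `&` [set a | lam a != 0]),
        forall a, A a -> 0 <= lam a,
        exists2 a, A a & 0 < lam a
      & v = \sum_(a \in A) lam a *: a]].

Definition lin_span A : set V :=
  smallest (fun E : set V => submod_closed [in E]) A.

Definition lin_span_pred A : {pred V} := [in lin_span A].

Lemma lin_span_submod_closed A : submod_closed (lin_span_pred A).
Proof.
split.
  by rewrite unfold_in; apply/mem_set => E [[E0 _] _]; move: E0; rewrite inE.
move=> c u v; rewrite !unfold_in => /set_mem uA /set_mem vA.
apply/mem_set => E EA; have [[_ EP] _] := EA.
by have := EP c u v; rewrite !inE; apply; [exact: uA|exact: vA].
Qed.

HB.instance Definition _ A :=
  GRing.isSubmodClosed.Build R V (lin_span_pred A) (lin_span_submod_closed A).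

End LinearCombinations.

(* [bond bform a b m] says that m = m_ab, with None standing for infinity. Since
   -1 < - cos (pi / k), and these values are pairwise distinct for k >= 2, at
   most one m is a bond of a and b; so m_ab need not be part of the datum. *)
Definition bond (R : realType) (V : Type) (bform : V -> V -> R) (a b : V)
    (m : option nat) : Prop :=
  if m is Some k then (2 <= k)%N /\ bform a b = - cos (pi / k%:R)
  else bform a b <= -1.

Record coxeterDatum (R : realType) (V : lmodType R) := CoxeterDatum {
  bform : {biscalar V};
  bformC : forall u v, bform u v = bform v u;
  Delta : set V;
  bform_Delta : forall a, Delta a -> bform a a = 1;
  Delta_bond : forall a b, Delta a -> Delta b -> a <> b ->
    exists m, bond bform a b m;
  Delta_pointed : ~ PLC Delta 0
}.

Definition has_order (G : groupType) (g : G) (m : option nat) : Prop :=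
  if m is Some k then
    [/\ (0 < k)%N, (g ^+ k = 1)%g
      & forall j, (0 < j < k)%N -> (g ^+ j <> 1)%g]
  else forall j, (0 < j)%N -> (g ^+ j <> 1)%g.

Definition coxeter_relations (R : realType) (V : lmodType R)
    (D : coxeterDatum V) (G : groupType) (f : V -> G) : Prop :=
  (forall a, Delta D a -> (f a ^+ 2 = 1)%g) /\
  (forall a b k, Delta D a -> Delta D b -> a <> b ->
    bond (bform D) a b (Some k) -> ((f a * f b) ^+ k = 1)%g).

(* W together with the reflections r_a (only the values of [refl] on Delta are
   meaningful) and its action on V. [refl_gen] and [refl_presentation] say that
   W is presented by the generators r_a and the Coxeter relations. *)
Record coxeterGroup (R : realType) (V : lmodType R) (D : coxeterDatum V) :=
  CoxeterGroup {
  cox_group :> groupType;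
  refl : V -> cox_group;
  refl_order : forall a, Delta D a -> has_order (refl a) (Some 2%N);
  refl_mul_order : forall a b m, Delta D a -> Delta D b -> a <> b ->
    bond (bform D) a b m -> has_order (refl a * refl b)%g m;
  refl_gen :
    smallest (fun H : set cox_group => group_closed [in H])
      (refl @` Delta D) = setT;
  refl_presentation : forall (G : groupType) (f : V -> G),
    coxeter_relations D f ->
    exists phi : {multiplicative cox_group -> G},
      forall a, Delta D a -> phi (refl a) = f a;
  cact : cox_group -> V -> V;
  cact1 : forall x, cact 1%g x = x;
  cactM : forall g h x, cact (g * h)%g x = cact g (cact h x);
  cact_refl : forall a x, Delta D a ->
    cact (refl a) x = x - (2 * bform D x a) *: a
}.

Section ImaginaryCone.
Context {R : realType} {V : lmodType R} (D : coxeterDatum V)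
  (W : coxeterGroup D).

Record X := MkX { X_val : V; X_valP : X_val \in lin_span_pred (Delta D) }.
HB.instance Definition _ := [isSub for X_val].
HB.instance Definition _ := [Choice of X by <:].
HB.instance Definition _ := [SubChoice_isSubLmodule of X by <:].

Lemma cox_ind (H : W -> Prop) :
  (forall a, Delta D a -> H (refl W a)) -> H 1%g ->
  (forall g h, H g -> H h -> H (g * h)%g) ->
  (forall g, H g -> H g^-1%g) -> forall w, H w.
Proof.
move=> Hr H1 HM HV w.
have : smallest (fun H : set W => group_closed [in H])
  (refl W @` Delta D) w by rewrite refl_gen.
apply; split; last by move=> _ [a /Hr ? <-].
split; first by apply/mem_set.
by move=> x y /set_mem Hx /set_mem Hy; apply/mem_set/HM => //; exact: HV.
Qed.

Lemma cactK (w : W) : cancel (cact w) (cact w^-1%g).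
Proof. by move=> x; rewrite -cactM mulVg cact1. Qed.

Lemma cactVK (w : W) : cancel (cact w^-1%g) (cact w).
Proof. by move=> x; rewrite -cactM mulgV cact1. Qed.

Lemma cact_linear (w : W) : linear (cact w).
Proof.
elim/cox_ind: w => [a Da c u v|c u v|g h gP hP c u v|g gP c u v].
- rewrite !cact_refl // linearPl /= mulrDr mulrCA scalerDl -scalerA.
  by rewrite opprD addrACA scalerBr !scalerA.
- by rewrite !cact1.
- by rewrite !cactM hP gP.
- by apply: (can_inj (cactK g)); rewrite gP !cactVK.
Qed.

Lemma cactB_span (w : W) (x : V) : cact w x - x \in lin_span_pred (Delta D).
Proof.
elim/cox_ind: w x => [a Da x|x|g h gP hP x|g gP x].
- rewrite cact_refl // addrC addKr rpredN rpredZ //.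
  by rewrite unfold_in; apply/mem_set => E [_]; exact.
- by rewrite cact1 subrr rpred0.
- by rewrite cactM -(subrK (cact h x) (cact g _)) -addrA rpredD.
- by rewrite -{2}(cactVK g x) -opprB rpredN.
Qed.

Lemma cact_span (w : W) (x : X) : cact w (val x) \in lin_span_pred (Delta D).
Proof. by rewrite -(subrK (val x) (cact _ _)) rpredD ?cactB_span ?(valP x). Qed.

Definition actX (w : W) (x : X) : X := Sub (cact w (val x)) (cact_span w x).

Definition dual_act_fun (w : W) (f : {scalar X}) : X -> R :=
  fun x => f (actX w^-1%g x).

Lemma dual_act_scalar (w : W) (f : {scalar X}) : scalar (dual_act_fun w f).
Proof.
move=> c u v; rewrite /dual_act_fun -linearP; congr (f _); apply: val_inj.
exact: cact_linear.
Qed.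

HB.instance Definition _ (w : W) (f : {scalar X}) :=
  GRing.isLinear.Build R X R *%R (dual_act_fun w f) (dual_act_scalar w f).

Definition dual_act (w : W) (f : {scalar X}) : {scalar X} := dual_act_fun w f.

Definition root_system : set V :=
  [set v | exists w : W, exists2 a, Delta D a & v = cact w a].

Definition pos_roots : set V := root_system `&` PLC (Delta D).

(* PLC Delta lies in its span, so viewing P in the subtype X loses nothing. *)
Definition cone : set X :=
  [set x | PLC (Delta D) (val x) \/ x = 0].

Definition dual_cone : set {scalar X} :=
  [set f | forall x, cone x -> 0 <= f x].

Definition tits_cone : set {scalar X} :=
  \bigcup_(w in [set: W]) (dual_act w @` dual_cone).

Definition tits_dual : set X :=
  [set x | forall f, tits_cone f -> 0 <= f x].

Definition imaginary_cone : set X :=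
  [set x | tits_dual x /\
    finite_set [set a | pos_roots a /\ ~ (bform D (val x) a <= 0)]].

End ImaginaryCone.

(* Main.v *)
(** A root is a nonnegative or a nonpositive combination of simple roots: if
    right multiplication by [r_a] does not shorten [w], then [w a] is
    nonnegative, by induction on the length of [w] through the dihedral subgroup
    generated by [r_a] and the last letter of [w]. Hence [r_a] permutes the
    positive roots other than [a], and each [w] makes finitely many positive
    roots negative.

    If [v] is in [P] and pairs nonpositively with the simple roots, removing the
    last letter of [w] shows [w v] to be a sum of elements of [P], so [w v] lies
    in [U*], and only the finitely many positive roots inverted by [w^-1] can
    pair positively with it. Conversely, if [x] in [Q] pairs positively with some
    positive root, it does so with a simple one [a], and replacing [x] by [r_a x]
    removes one such root; this ends at some [w x] pairing nonpositively with all
    positive roots. As [w x] is in [U*], it is in the bidual of [P], which is [P]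
    by Farkas' lemma because [Delta] is finite. *)
Require Import Defs.
From HB Require Import structures.
From mathcomp Require Import all_boot all_order all_algebra.
From mathcomp Require Import finmap all_classical all_reals.
From mathcomp Require Import trigo.
From mathcomp Require Import ring lra.
Import Order.TTheory GRing.Theory Num.Theory.

Set Implicit Arguments.
Unset Strict Implicit.
Unset Printing Implicit Defensive.

Local Open Scope classical_set_scope.
Local Open Scope ring_scope.

(** * Farkas' lemma *)

(** By Zorn's lemma some subspace is maximal among those avoiding [v]; it is a complement of the
    line through [v], and [f] is the coordinate along [v]. *)
Lemma separating_functional (F : fieldType) (E : lmodType F) (v : E) :
  v != 0 -> exists f : {scalar E}, f v = 1.
Proof.
move=> v0.
(* Membership of [0] is left out, so that the empty set, the union of the empty chain, satisfies
   [P]. *)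
pose P (M : set E) :=
  (forall c u w, M u -> M w -> M (c *: u + w)) /\ ~ M v.
have [M [[Mlin Mv] Mmax]] : exists M, P M /\ forall B, M `<` B -> ~ P B.
  apply: Zorn_bigcup => C CP Ctot; split => [c u w [A CA Au] [B CB Bw]|].
    have [AB|BA] := Ctot _ _ CA CB.
      by exists B => //; apply: (CP _ CB).1 => //; exact: AB.
    by exists A => //; apply: (CP _ CA).1 => //; exact: BA.
  by move=> [A CA]; exact: (CP _ CA).2.
have M0 : M 0.
  apply: contrapT => nM0; apply: (Mmax [set 0]); last first.
    by split=> [c u w -> ->|/eqP]; [rewrite scaler0 addr0|exact/negP].
  split=> [u Mu|/(_ 0 erefl)//].
  by case: nM0; rewrite -(addNr u) -scaleN1r; exact: Mlin.
have MZ c u : M u -> M (c *: u) by rewrite -[_ *: _]addr0 => ?; exact: Mlin.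
have MD u w : M u -> M w -> M (u + w) by rewrite -{2}[u]scale1r; exact: Mlin.
have coord x : exists t, M (x - t *: v).
  apply: contrapT => nx.
  have {}nx t : ~ M (x - t *: v) by move=> Mt; apply: nx; exists t.
  (* By maximality [M] enlarged by the line through [x] would contain [v]; solving for [x] gives its
     coordinate. *)
  apply: (Mmax [set y | exists t, M (y - t *: x)]).
    split=> [u Mu|sub]; first by exists 0; rewrite scale0r subr0.
    apply: (nx 0); rewrite scale0r subr0; apply: sub.
    by exists 1; rewrite scale1r subrr.
  split=> [c u w [t Mt] [s Ms]|[t Mt]].
    exists (c * t + s); have := Mlin c _ _ Mt Ms.
    by rewrite scalerBr scalerDl opprD addrACA scalerA.
  have [t0|t0] := eqVneq t 0.
    by move: Mt; rewrite t0 scale0r subr0.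
  apply: (nx t^-1); rewrite -(scale1r x) -(mulVf t0) -scalerA -scalerBr.
  by apply: (MZ); rewrite -opprB -scaleN1r; exact: MZ.
pose f x := projT1 (cid (coord x)).
have fP x : M (x - f x *: v) by rewrite /f; case: cid.
have f_unique x t : M (x - t *: v) -> t = f x.
  move=> Mt; apply: contrapT => /eqP; rewrite -subr_eq0 => tf; apply: Mv.
  rewrite -(scale1r v) -(mulVf tf) -scalerA scalerBl; apply: (MZ).
  have := MD _ _ (fP x) (MZ (-1) _ Mt).
  by rewrite scaleN1r opprB addrC addrA subrK.
have f_lin : scalar f.
  move=> c u w; apply/esym/f_unique.
  have := Mlin c _ _ (fP u) (fP w).
  by rewrite scalerBr scalerDl opprD addrACA scalerA.
pose fL := GRing.isLinear.Build F E F *%R f f_lin.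
pose g : {scalar E} := HB.pack f fL.
exists g; rewrite /g /=.
by apply/esym/f_unique; rewrite scale1r subrr.
Qed.

Fixpoint conic (R : numDomainType) (E : lmodType R) (s : seq E) (v : E) : Prop :=
  if s is a :: s' then exists2 t, 0 <= t & conic s' (v - t *: a) else v = 0.

Lemma conic_map (R : realFieldType) (E : lmodType R) (s : seq E)
    (f : {scalar E}) (p : {linear E -> E}) (y : E) :
  (forall b, b \in s -> 0 <= f b) -> conic (map p s) y ->
  exists z, [/\ conic s z, 0 <= f z & y = p z].
Proof.
elim: s y => [|b s IH] y fs /=; first by move=> ->; exists 0; rewrite !linear0.
move=> [t t0 /IH[c cs|z [zs fz yE]]].
  by apply: fs; rewrite in_cons cs orbT.
exists (z + t *: b); split.
- by exists t => //; rewrite addrK.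
- by rewrite linearD linearZ addr_ge0 //= mulr_ge0 // fs // mem_head.
- by rewrite linearD linearZ /= -yE subrK.
Qed.

(* Induction on the generators: if [f] separates [v] from all of [s] but is
   negative at the new generator [a], project along [a] onto the kernel of [f]. *)
Lemma farkas (R : realFieldType) (E : lmodType R) (s : seq E) (v : E) :
  ~ conic s v ->
  exists f : {scalar E}, (forall a, a \in s -> 0 <= f a) /\ f v < 0.
Proof.
have [n] := ubnP (size s); elim: n s v => // n IH [|a s] v.
  move=> _ /= /eqP; rewrite -oppr_eq0 => /separating_functional[f fNv].
  by exists f; split=> //; rewrite -[v]opprK linearN fNv ltrN10.
rewrite ltnS /= => sn nv.
have [|f [fs fv]] := IH s v sn.
  by move=> sv; apply: nv; exists 0 => //; rewrite scale0r subr0.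
have [fa|fa] := leP 0 (f a).
  exists f; split=> // b; rewrite in_cons => /predU1P[->//|]; exact: fs.
pose p x := x - (f x / f a) *: a.
have p_lin : linear p.
  move=> c x y; rewrite /p linearP /= mulrDl -mulrA scalerDl scalerBr.
  by rewrite -scalerA opprD addrACA.
pose pL := GRing.isLinear.Build R E E *:%R p p_lin.
pose q : {linear E -> E} := HB.pack p pL.
have [||g [gs gv]] := IH (map q s) (q v); first by rewrite size_map.
  move=> /(conic_map fs)[z [zs fz pvE]]; apply: nv.
  (* Solving [p v = p z] for [v] gives this coefficient of [a]; it is nonnegative because
     [f v < 0 <= f z] and [f a < 0]. *)
  exists (f v / f a - f z / f a).
    by rewrite -mulrBl mulr_le0 // ?invr_le0 ?ltW // subr_lt0 (lt_le_trans fv).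
  move: pvE; rewrite /q /= /p => pvE.
  by rewrite scalerBl opprB addrCA pvE addrC subrK.
have h_lin : scalar (g \o q) by move=> c x y; rewrite /comp !linearP.
pose hL := GRing.isLinear.Build R E R *%R (g \o q) h_lin.
pose h : {scalar E} := HB.pack (g \o q) hL.
exists h; rewrite /h /=; split=> // b; rewrite in_cons => /predU1P[->|bs].
  by rewrite /p divff ?lt_eqF // scale1r subrr linear0.
by apply: gs; exact: map_f.
Qed.

(** * The cone over a finite set *)

Section Cone.
Context {R : realType} {V : lmodType R} (A : set V).
Hypothesis finA : finite_set A.

(* Meaningful for finite [A] only, [fset_set A] being empty otherwise. *)
Definition ncone : set V :=
  [set v | exists2 lam : V -> R, forall a, A a -> 0 <= lam a
    & v = \sum_(a <- fset_set A) lam a *: a].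

Lemma mem_fset_set a : (a \in fset_set A : Prop) <-> A a.
Proof. by rewrite in_fset_set //; split=> [/set_mem|/mem_set]. Qed.

Lemma ncone0 : ncone 0.
Proof. by exists (fun=> 0) => //; rewrite big1 // => a _; rewrite scale0r. Qed.

Lemma nconeD u v : ncone u -> ncone v -> ncone (u + v).
Proof.
move=> [l l0 ->] [m m0 ->]; exists (fun a => l a + m a).
  by move=> a Aa; rewrite addr_ge0 ?l0 ?m0.
by rewrite -big_split; apply: eq_bigr => a _; rewrite scalerDl.
Qed.

Lemma nconeZ c v : 0 <= c -> ncone v -> ncone (c *: v).
Proof.
move=> c0 [l l0 ->]; exists (fun a => c * l a).
  by move=> a Aa; rewrite mulr_ge0 ?l0.
by rewrite scaler_sumr; apply: eq_bigr => a _; rewrite scalerA.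
Qed.

Lemma ncone_mem a : A a -> ncone a.
Proof.
move=> Aa; exists (fun b => (b == a)%:R) => [b _|]; first exact: ler0n.
have /mem_fset_set aA := Aa.
rewrite (big_rem a) //= eqxx scale1r big1_seq ?addr0 // => b /andP[_ bA].
case: eqP bA => [->|_ _]; last by rewrite scale0r.
by rewrite mem_rem_uniq ?fset_uniq // inE eqxx.
Qed.

(** As [A] may be linearly dependent, the absence of a term in [a] from [w] is recorded through its
    effect on functionals. *)
Lemma ncone_split a v : A a -> ncone v ->
  exists t w, [/\ 0 <= t, v = t *: a + w, ncone w
    & forall g : {scalar V}, (forall b, A b -> b <> a -> g b <= 0) -> g w <= 0].
Proof.
move=> Aa [l l0 vE]; have /mem_fset_set aA := Aa.
exists (l a), (\sum_(b <- fset_set A) (if b == a then 0 else l b) *: b).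
split; [exact: l0| | |].
- rewrite vE (big_rem a) //= [in RHS](big_rem a) //= eqxx scale0r add0r.
  congr (_ + _); apply: eq_big_seq => b.
  by rewrite mem_rem_uniq ?fset_uniq // inE => /andP[/negbTE->].
- by eexists; [|reflexivity] => b Ab /=; case: eqP => // _; exact: l0.
- move=> g gb; rewrite linear_sum big_seq_cond sumr_le0 // => b /andP[+ _].
  move=> /mem_fset_set Ab; rewrite linearZ /=; case: eqP => [_|/gb bg].
    by rewrite mul0r.
  by rewrite mulr_ge0_le0 ?l0 ?bg.
Qed.

Lemma ncone_le0 (g : {scalar V}) v :
  (forall a, A a -> g a <= 0) -> ncone v -> g v <= 0.
Proof.
move=> gA [l l0 ->]; rewrite linear_sum big_seq_cond sumr_le0 // => a.
by move=> /andP[/mem_fset_set Aa _]; rewrite linearZ mulr_ge0_le0 ?l0 ?gA.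
Qed.

Lemma PLC_ncone v : PLC A v -> ncone v.
Proof.
by move=> [l [_ l0 _ ->]]; exists l => //; rewrite fsbig_finite.
Qed.

Lemma ncone_PLC v : ncone v -> v != 0 -> PLC A v.
Proof.
move=> [l l0 ->] v0; exists l; split=> //.
- exact: sub_finite_set finA.
- apply: contrapT => npos; move/eqP: v0; apply; apply: big1_seq => a /andP[_].
  move=> /mem_fset_set Aa; suff -> : l a = 0 by rewrite scale0r.
  apply/le_anti; rewrite l0 // andbT leNgt; apply/negP => la.
  by apply: npos; exists a.
- by rewrite fsbig_finite.
Qed.

Hypothesis pointed : ~ PLC A 0.

Lemma PLC_neq0 v : PLC A v -> v != 0.
Proof. by move=> Av; apply/eqP => v0; apply: pointed; rewrite -v0. Qed.

(** Adding the combinations for [v] and [- v] gives [0], so a positive coefficient would put [0] in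
    [PLC A]. *)
Lemma ncone_pointed v : ncone v -> ncone (- v) -> v = 0.
Proof.
move=> [l l0 vE] [m m0 NvE]; rewrite vE; apply: big1_seq => a /andP[_].
move=> /mem_fset_set Aa; suff -> : l a = 0 by rewrite scale0r.
apply/le_anti; rewrite l0 // andbT leNgt; apply/negP => la; apply: pointed.
exists (fun b => l b + m b); split.
- exact: sub_finite_set finA.
- by move=> b Ab; rewrite addr_ge0 ?l0 ?m0.
- by exists a => //; rewrite ltr_pwDl ?m0.
- rewrite fsbig_finite //=; under eq_bigr do rewrite scalerDl.
  by rewrite big_split /= -vE -NvE subrr.
Qed.

End Cone.

(** * Dihedral groups *)

(* U_(k-1)(g), for U the Chebyshev polynomials of the second kind. *)
Fixpoint cheb (R : pzRingType) (g : R) (k : nat) : R :=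
  if k is k1.+1 then
    if k1 is k2.+1 then 2 * g * cheb g k1 - cheb g k2 else 1
  else 0.

Lemma chebSS (R : pzRingType) (g : R) k :
  cheb g k.+2 = 2 * g * cheb g k.+1 - cheb g k.
Proof. by []. Qed.

Lemma cheb_cos (R : realType) (t : R) k :
  cheb (cos t) k * sin t = sin (k%:R * t).
Proof.
suff : cheb (cos t) k * sin t = sin (k%:R * t) /\
  cheb (cos t) k.+1 * sin t = sin (k.+1%:R * t) by case.
elim: k => [|k [IH IH1]]; first by rewrite /= !mul0r sin0 !mul1r.
split=> //; rewrite chebSS mulrBl IH -mulrA IH1.
have -> : k.+2%:R * t = k.+1%:R * t + t by rewrite -[k.+2]addn1 natrD; ring.
have -> : k%:R * t = k.+1%:R * t - t by rewrite -[k.+1]addn1 natrD; ring.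
rewrite sinB sinD; ring.
Qed.

(** Multiplying by [sin (pi / m) > 0] gives [sin (k pi / m)], whose angle lies in [[0, pi]]. *)
Lemma cheb_cos_ge0 (R : realType) m k : (1 < m)%N -> (k <= m)%N ->
  0 <= cheb (cos (pi / m%:R) : R) k.
Proof.
move=> m1 km; have m0 : 0 < m%:R :> R by rewrite ltr0n (ltn_trans _ m1).
have sin_gt0 : 0 < sin (pi / m%:R : R).
  apply: sin_gt0_pi; rewrite divr_gt0 ?pi_gt0 //= ltr_pdivrMr //.
  by rewrite ltr_pMr ?pi_gt0 // ltr1n.
rewrite -(pmulr_lge0 _ sin_gt0) cheb_cos sin_ge0_pi //.
rewrite mulr_ge0 ?divr_ge0 ?pi_ge0 ?ler0n //=.
by rewrite mulrCA ler_piMr ?pi_ge0 // ler_pdivrMr // mul1r ler_nat.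
Qed.

Lemma cheb_ge0 (R : realDomainType) (g : R) k : 1 <= g -> 0 <= cheb g k.
Proof.
(* Strengthened to monotonicity: for [g >= 1] the recursion gives
   [c_(k+2) >= 2 c_(k+1) - c_k >= c_(k+1)]. *)
move=> g1; suff : 0 <= cheb g k <= cheb g k.+1 by case/andP.
elim: k => [|k /andP[IH IH1]]; first by rewrite /= lexx ler01.
rewrite (le_trans IH IH1) chebSS; have := le_trans IH IH1; nra.
Qed.

Section Alternating.
Context {G : groupType}.
Local Open Scope group_scope.

(* The alternating word ... g h g h of length [k] ending in [h]. *)
Fixpoint alt (g h : G) (k : nat) : G :=
  if k is k'.+1 then alt h g k' * h else 1.

Lemma alt_left (g h : G) k :
  alt g h k.+1 = (if odd k then g else h) * alt g h k.
Proof.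
elim: k g h => [|k IH] g h; first by rewrite /= mul1g mulg1.
rewrite -[LHS]/(alt h g k.+1 * h) IH mulgA /=.
by case: (odd k).
Qed.

Lemma alt_even (g h : G) k : alt g h k.*2 = (g * h) ^+ k.
Proof. by elim: k => //= k ->; rewrite expgSr mulgA. Qed.

(** This is the braid form of the relation; it follows because [(h * g) ^+ k] is the inverse of
    [(g * h) ^+ k] for involutions. *)
Lemma alt_comm (g h : G) m : g * g = 1 -> h * h = 1 -> (g * h) ^+ m = 1 ->
  alt g h m = alt h g m.
Proof.
move=> gg hh ghm.
have gV : g^-1 = g by apply: mulg1_eq.
have hV : h^-1 = h by apply: mulg1_eq.
have VE k : (h * g) ^+ k = (g * h) ^- k by rewrite -expVgn invgM gV hV.
move: ghm; rewrite -(odd_double_half m); set k := m./2.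
case: (odd m); rewrite ?add1n ?add0n /= !alt_even VE => ghm.
  apply: (mulIg h); rewrite -!mulgA hh mulg1 -expgSr; apply: mulg1_eq.
  by rewrite -expgnDr addnS addnn.
by apply/esym/mulg1_eq; rewrite -expgnDr addnn.
Qed.

End Alternating.

(** * Length and roots *)

Section Roots.
Context {R : realType} {V : lmodType R} (D : coxeterDatum V)
  (W : coxeterGroup D).
Local Notation B := (bform D).
Local Notation r := (refl W).

Lemma cactD (w : W) u v : cact w (u + v) = cact w u + cact w v.
Proof. by have := cact_linear w 1 u v; rewrite !scale1r. Qed.

Lemma cact0 (w : W) : cact w 0 = 0.
Proof. by apply: (addrI (cact w 0)); rewrite -cactD !addr0. Qed.

Lemma cactZ (w : W) c v : cact w (c *: v) = c *: cact w v.
Proof. by have := cact_linear w c v 0; rewrite cact0 !addr0. Qed.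

Lemma cactN (w : W) v : cact w (- v) = - cact w v.
Proof. by rewrite -!scaleN1r cactZ. Qed.

Lemma refl_sqr a : Delta D a -> (r a * r a = 1)%g.
Proof. by move=> Da; have [_] := @refl_order _ _ _ W _ Da; rewrite expg2. Qed.

Lemma reflV a : Delta D a -> ((r a)^-1 = r a)%g.
Proof. by move=> Da; apply: mulg1_eq; exact: refl_sqr. Qed.

Lemma cact_refl_self a : Delta D a -> cact (r a) a = - a.
Proof.
move=> Da; rewrite cact_refl // bform_Delta // mulr1 scaler_nat mulr2n.
by rewrite opprD addrA subrr sub0r.
Qed.

Lemma cact_reflK a : Delta D a -> involutive (cact (r a)).
Proof. by move=> Da v; rewrite -cactM refl_sqr // cact1. Qed.

Lemma bform_cact (w : W) u v : B (cact w u) (cact w v) = B u v.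
Proof.
elim/(@cox_ind _ _ _ W): w u v => [a Da u v|u v|g h gP hP u v|g gP u v].
- rewrite !cact_refl // linearBl /= !linearBr /= !linearZl_LR /= !linearZr_LR /=.
  by rewrite (bform_Delta Da) (bformC D a v); ring.
- by rewrite !cact1.
- by rewrite !cactM gP hP.
- by rewrite -gP !cactVK.
Qed.

Lemma bform_Delta_le0 a b : Delta D a -> Delta D b -> a <> b -> B a b <= 0.
Proof.
move=> Da Db /(Delta_bond Da Db)[[k [k2 ->]|le]]; last first.
  by rewrite (le_trans le) // lerN10.
have k0 : 0 < k%:R :> R by rewrite ltr0n (ltn_trans _ k2).
rewrite oppr_le0 cos_ge0_pihalf // (@le_trans _ _ 0) ?oppr_le0 /=.
- by rewrite ler_pM2l ?pi_gt0 // lef_pV2 ?posrE ?ler_nat.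
- by rewrite divr_ge0 ?pi_ge0.
- by rewrite divr_ge0 ?pi_ge0 ?ltW.
Qed.

(** * Word length in the simple reflections *)

Section Length.
Local Open Scope group_scope.

Fixpoint simple_product (n : nat) : set W :=
  if n is n'.+1 then
    [set w | exists a v, [/\ Delta D a, simple_product n' v & w = v * r a]]
  else [set 1].

Lemma simple_productM m n u v :
  simple_product m u -> simple_product n v -> simple_product (m + n) (u * v).
Proof.
elim: n v => [|n IH] v um /=; first by move=> ->; rewrite addn0 mulg1.
move=> [a [v' [Da v'n ->]]]; rewrite addnS; exists a, (u * v').
by split; [|exact: IH|rewrite mulgA].
Qed.

Lemma simple_product1 a : Delta D a -> simple_product 1 (r a).
Proof. by move=> Da; exists a, 1; split; rewrite ?mul1g. Qed.

Lemma simple_productV n v : simple_product n v -> simple_product n v^-1.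
Proof.
elim: n v => [|n IH] v; first by move=> /= ->; rewrite invg1.
move=> [a [u [Da un ->]]]; rewrite invgM reflV // -(add1n n).
by apply: simple_productM; [exact: simple_product1|exact: IH].
Qed.

Lemma simple_product_ex w : exists n, `[< simple_product n w >].
Proof.
suff [n wn] : exists n, simple_product n w by exists n; apply/asboolP.
elim/(@cox_ind _ _ _ W): w => [a Da||g h [m gm] [n hn]|g [n gn]].
- by exists 1%N; exact: simple_product1.
- by exists 0%N.
- by exists (m + n)%N; exact: simple_productM.
- by exists n; exact: simple_productV.
Qed.

Definition ell w := ex_minn (simple_product_ex w).

Lemma ellP w : simple_product (ell w) w.
Proof. by rewrite /ell; case: ex_minnP => n /asboolP. Qed.

Lemma ell_min n w : simple_product n w -> (ell w <= n)%N.
Proof. by move=> wn; rewrite /ell; case: ex_minnP => m _; apply; apply/asboolP. Qed.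

Lemma ellM u v : (ell (u * v) <= ell u + ell v)%N.
Proof. by apply: ell_min; apply: simple_productM; exact: ellP. Qed.

Lemma ell_refl a : Delta D a -> (ell (r a) <= 1)%N.
Proof. by move=> Da; apply: ell_min; exact: simple_product1. Qed.

Lemma ell_eq0 w : ell w = 0%N -> w = 1.
Proof. by move=> w0; have := ellP w; rewrite w0. Qed.

Lemma ell_last n w : ell w = n.+1 ->
  exists a v, [/\ Delta D a, ell v = n & w = v * r a].
Proof.
move=> wn; have := ellP w; rewrite {1}wn => -[a [v [Da vn wE]]].
exists a, v; split=> //; apply/eqP; rewrite eqn_leq ell_min //=.
have := leq_trans (ellM v (r a)) (leq_add (leqnn _) (ell_refl Da)).
by rewrite -wE wn addn1 ltnS.
Qed.

Lemma ell_alt a b k : Delta D a -> Delta D b -> (ell (alt (r a) (r b) k) <= k)%N.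
Proof.
elim: k a b => [|k IH] a b Da Db; first exact: ell_min.
rewrite /= (leq_trans (ellM _ _)) // -addn1 leq_add ?IH //; exact: ell_refl.
Qed.

Lemma alt_addn a b p m : Delta D a -> Delta D b ->
  exists2 u, (ell u <= p)%N &
    alt (r a) (r b) (p + m) = u * alt (r a) (r b) m.
Proof.
elim: m a b => [|m IH] a b Da Db.
  by exists (alt (r a) (r b) p); [exact: ell_alt|rewrite addn0 mulg1].
by have [u up uE] := IH b a Db Da; exists u => //; rewrite addnS /= uE mulgA.
Qed.

End Length.

(** The letter added on the left negates one of the two roots and shifts the other by a multiple of
    it, which is one step of the Chebyshev recursion. *)
Lemma cact_alt a b k : Delta D a -> Delta D b ->
  cact (alt (r a) (r b) k) a =
  cheb (- B a b) k.+1 *: (if odd k then b else a)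
  + cheb (- B a b) k *: (if odd k then a else b).
Proof.
move=> Da Db; elim: k => [|k IH].
  by rewrite /= cact1 scale1r scale0r addr0.
rewrite alt_left cactM IH cactD !cactZ chebSS scalerBl.
have ab : B b a = B a b by exact: bformC.
move: (cheb _ k.+1) (cheb _ k) => c1 c0.
suff key (x y : V) : c1 *: (x - (2 * B a b) *: y) + c0 *: - y =
    (2 * - B a b * c1) *: y - c0 *: y + c1 *: x.
  rewrite [odd k.+1]/=; case: (odd k); rewrite /= ?(cact_refl_self Da)
    ?(cact_refl_self Db) ?(cact_refl _ _ Da) ?(cact_refl _ _ Db) ?ab; exact: key.
rewrite [RHS]addrC addrA scalerBr scalerA scalerN -scaleNr.
by congr (_ + _ *: _ - _); ring.
Qed.

Lemma simple_cheb_ge0 a b k : Delta D a -> Delta D b -> a <> b ->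
  (forall m, bond B a b (Some m) -> (k <= m)%N) -> 0 <= cheb (- B a b) k.
Proof.
move=> Da Db ab km; have [[m bm|le]] := Delta_bond Da Db ab; last first.
  by rewrite cheb_ge0 // lerNr.
by have [m2 Bab] := bm; rewrite Bab opprK cheb_cos_ge0 //; exact: km.
Qed.

Hypothesis finD : finite_set (Delta D).
Local Notation C := (ncone (Delta D)).

(* A descent [b <> a] of [w] gives [w = v * (... r_a r_b)] with the alternating
   factor as long as possible; then neither [a] nor [b] is a descent of [v], and
   [w a] is a nonnegative combination of [v a] and [v b] by [cact_alt]. *)
Lemma cact_simple_ncone (w : W) a : Delta D a ->
  (ell w <= ell (w * r a)%g)%N -> C (cact w a).
Proof.
have [n] := ubnP (ell w); elim: n w a => // n IH w a; rewrite ltnS => wn Da wa.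
case E : (ell w) => [|l].
  by rewrite (ell_eq0 E) cact1; exact: ncone_mem.
have [b [v0 [Db v0l wE]]] := ell_last E.
have ab : a <> b.
  move=> ab; move: wa; rewrite {2}wE ab -mulgA refl_sqr // mulg1 v0l E.
  by rewrite ltnn.
(* For [k > 0], [x k] is the leftmost letter of the alternating word of length [k]. *)
pose x k := if odd k then b else a.
have Dx k : Delta D (x k) by rewrite /x; case: ifP.
have altS k : (alt (r a) (r b) k.+1 = r (x k.+1) * alt (r a) (r b) k)%g.
  by rewrite alt_left /x /=; case: odd.
pose P k := `[< exists v : W, (w = v * alt (r a) (r b) k)%g /\
                             (ell v + k = ell w)%N >].
have P1 : P 1%N.
  by apply/asboolP; exists v0; rewrite /= mul1g v0l E addn1.
have Pub k : P k -> (k <= ell w)%N.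
  by move=> /asboolP[v [_ <-]]; exact: leq_addl.
have [k /asboolP[v [wv lv]] kmax] := ex_maxnP (ex_intro (fun k => is_true (P k)) _ P1) Pub.
have k0 : (0 < k)%N by exact: kmax.
(* Otherwise the alternating factor could absorb one more letter from [v], against the maximality of
   [k]. *)
have vup : (ell v <= ell (v * r (x k.+1))%g)%N.
  rewrite leqNgt; apply/negP => lt.
  suff /kmax : P k.+1 by rewrite ltnn.
  have wv' : (w = v * r (x k.+1) * alt (r a) (r b) k.+1)%g.
    by rewrite altS mulgA -(mulgA v) refl_sqr // mulg1.
  apply/asboolP; exists (v * r (x k.+1))%g; split=> //.
  apply/eqP; rewrite eqn_leq; apply/andP; split.
    by rewrite addnS -addSn -lv leq_add2r.
  rewrite {1}wv' (leq_trans (ellM _ _)) // leq_add2l; exact: ell_alt.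
(* Here [w] is [v * r (x k)] times an alternating word of length [k - 1], while
   [ell w = ell v + k]. *)
have vdown : (ell v <= ell (v * r (x k))%g)%N.
  case: k {kmax vup} k0 lv wv => // k _ lv; rewrite altS mulgA => wv.
  have := leq_trans (ellM (v * r (x k.+1))%g _)
    (leq_add (leqnn _) (ell_alt k Da Db)).
  by rewrite -wv -lv addnS -addSn leq_add2r; exact: ltnW.
have vn : (ell v < n)%N by rewrite (leq_trans _ wn) // -lv -addn1 leq_add2l.
have Cva : C (cact v (x k)) by exact: IH.
have Cvb : C (cact v (x k.+1)) by exact: IH.
(* If [m <= k], the braid relation makes the alternating factor end in [r a], so [w * r a] would be
   shorter than [w]. Thus both [k] and [k + 1] are at most [m], as the signs of the two Chebyshev
   coefficients require. *)
have km m : bond B a b (Some m) -> (k < m)%N.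
  move=> bm; rewrite ltnNge; apply/negP => mk.
  have [m0 abm _] := refl_mul_order W Da Db ab bm.
  have [u uk] := alt_addn (k - m) m Da Db.
  rewrite subnK // (alt_comm _ _ abm) ?refl_sqr //; move: wa.
  case: m m0 mk abm uk {bm} => // m _ mk _ uk /= + altE.
  have -> : (w * r a = v * (u * alt (r a) (r b) m))%g.
    by rewrite wv altE -!mulgA refl_sqr // mulg1.
  apply/negP; rewrite -ltnNge (leq_ltn_trans (ellM _ _)) // -lv ltn_add2l.
  rewrite (leq_ltn_trans (ellM _ _)) //.
  rewrite (leq_ltn_trans (leq_add uk (ell_alt m Da Db))) //.
  by rewrite -addnS subnK.
rewrite wv cactM cact_alt // cactD !cactZ.
apply: nconeD; apply: nconeZ; rewrite ?simple_cheb_ge0 //.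
- by move=> m /km /ltnW.
- by move: Cvb; rewrite /x /=; case: odd.
Qed.

(** * Signs of roots and inversions *)

Lemma simple_root a : Delta D a -> root_system W a.
Proof. by move=> Da; exists 1%g, a => //; rewrite cact1. Qed.

Lemma cact_root (w : W) a : root_system W a -> root_system W (cact w a).
Proof. by move=> [g [b Db ->]]; exists (w * g)%g, b => //; rewrite cactM. Qed.

Lemma root_norm a : root_system W a -> B a a = 1.
Proof. by move=> [w [b Db ->]]; rewrite bform_cact bform_Delta. Qed.

Lemma pos_rootsP a : pos_roots W a <-> root_system W a /\ C a.
Proof.
split=> [[Ra /(PLC_ncone finD)//]|[Ra Ca]]; split=> //; apply: ncone_PLC => //.
apply/eqP => a0; have := root_norm Ra.
by rewrite a0 linear0l => /esym/eqP; rewrite oner_eq0.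
Qed.

Lemma pos_rootsN a : pos_roots W a -> ~ C (- a).
Proof.
move=> [Ra Da]; move: (PLC_ncone finD Da) => /(ncone_pointed finD) /[apply].
move=> /(_ (@Delta_pointed _ _ D)); apply/eqP; apply: PLC_neq0 Da.
exact: Delta_pointed.
Qed.

(** If [r b] shortens [w], then it lengthens [w * r b], which sends [b] to [- w b]. *)
Lemma root_sign a : root_system W a -> C a \/ C (- a).
Proof.
move=> [w [b Db ->]].
have [le|/ltnW le] := leqP (ell w) (ell (w * r b)%g).
  by left; exact: cact_simple_ncone.
right; rewrite -cactN -cact_refl_self // -cactM; apply: cact_simple_ncone => //.
by rewrite -mulgA refl_sqr // mulg1.
Qed.

Lemma simple_pos_root a : Delta D a -> pos_roots W a.
Proof.
by move=> Da; apply/pos_rootsP; split; [exact: simple_root|exact: ncone_mem].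
Qed.

(* Write [b = t a + b'] and [- r_a b = s a + p'], with [b'] and [p'] supported off
   [a]. Adding up, a multiple of [a] equals [b' + p'], whose product with [a] is
   nonpositive; pointedness then forces [b' = 0]. *)
Lemma cact_refl_pos_root a b : Delta D a -> pos_roots W b -> b <> a ->
  pos_roots W (cact (r a) b).
Proof.
move=> Da /pos_rootsP[Rb Cb] ba; apply/pos_rootsP.
have Rrb := cact_root (r a) Rb; split=> //.
have [//|Cn] := root_sign Rrb; case: ba.
have le0 c : Delta D c -> c <> a -> B a c <= 0.
  by move=> Dc ca; rewrite bform_Delta_le0 // => /esym.
have [t [b' [t0 bE Cb' /(_ (B a) le0) b'a]]] := ncone_split finD Da Cb.
have [s [p' [s0 pE Cp' /(_ (B a) le0) p'a]]] := ncone_split finD Da Cn.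
pose m := 2 * B b a - t - s.
have sumE : b' + p' = m *: a.
  have -> : b' = b - t *: a by rewrite bE addrC addKr.
  have -> : p' = - cact (r a) b - s *: a by rewrite pE addrC addKr.
  by rewrite cact_refl // opprB /m !scalerBl addrA (addrC (b - _)) addrA subrK.
have m0 : m <= 0.
  have <- : B a (b' + p') = m.
    by rewrite sumE linearZr_LR /= bform_Delta // mulr1.
  by rewrite linearDr -[0]addr0 lerD.
have b'0 : b' = 0.
  apply: (ncone_pointed finD (@Delta_pointed _ _ D) Cb').
  have -> : - b' = p' + (- m) *: a.
    by rewrite scaleNr -sumE opprD addrCA subrr addr0.
  by apply: nconeD => //; apply: nconeZ; rewrite ?oppr_ge0 //; exact: ncone_mem.
have := root_norm Rb; rewrite bE b'0 addr0 linearZl_LR /= linearZr_LR /=.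
rewrite (bform_Delta Da) mulr1 -expr2 => /eqP.
by rewrite sqrp_eq1 // => /eqP ->; rewrite scale1r.
Qed.

(** A root inverted by [v * r a] is either [a] or the image under [r a] of a root inverted by
    [v]. *)
Lemma finite_inversions (w : W) :
  finite_set [set b | pos_roots W b /\ ~ pos_roots W (cact w b)].
Proof.
move: (ell w) (ellP w) => n; elim: n w => [|n IH] w /=.
  move=> ->; apply: sub_finite_set (finite_set0 V) => b [].
  by rewrite cact1.
move=> [a [v [Da vn ->]]].
apply: (@sub_finite_set _ _
  ([set a] `|` cact (r a) @` [set b | pos_roots W b /\ ~ pos_roots W (cact v b)])).
  move=> b [pb nb]; have [->|/eqP ba] := eqVneq b a; first by left.
  right; exists (cact (r a) b); last exact: cact_reflK.
  by split; [exact: cact_refl_pos_root|rewrite -cactM].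
by rewrite finite_setU; split=> //; apply/finite_image/IH.
Qed.

(** * Antidominant vectors and their orbits *)

Lemma cact_antidominant_ncone (w : W) v : C v ->
  (forall a, Delta D a -> B v a <= 0) -> C (cact w v).
Proof.
move=> Cv va; have [n] := ubnP (ell w); elim: n w => // n IH w.
rewrite ltnS => wn; case E : (ell w) => [|l]; first by rewrite (ell_eq0 E) cact1.
have [a [u [Da ul wE]]] := ell_last E.
have uw : (ell u < ell w)%N by rewrite ul E.
(* This is [w v = u v - 2 (v, a) u a], where [u a] is nonnegative because [r a] lengthens [u]. *)
rewrite wE cactM cact_refl // -scaleNr cactD cactZ; apply: nconeD.
  by apply: IH; exact: leq_trans wn.
apply: nconeZ; first by rewrite oppr_ge0 mulr_ge0_le0 // va.
by apply: cact_simple_ncone; rewrite // -wE ltnW.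
Qed.

Lemma antidominant_conjugate x :
  finite_set [set b | pos_roots W b /\ ~ (B x b <= 0)] ->
  exists w : W, forall b, pos_roots W b -> B (cact w x) b <= 0.
Proof.
move=> /finite_seqP[s sE].
(* Only this inclusion is kept as the invariant, so [s] may contain further elements or
   repetitions. *)
have {sE} : forall b, pos_roots W b -> 0 < B x b -> b \in s.
  move=> b pb xb; suff : [set` s] b by [].
  by rewrite -sE; split=> //; apply/negP; rewrite -ltNge.
have [n] := ubnP (size s); elim: n s x => // n IH s x; rewrite ltnS => sn sx.
have [xneg|] := pselect (forall b, pos_roots W b -> B x b <= 0).
  by exists 1%g => b; rewrite cact1; exact: xneg.
move=> nx; have [a Da xa] : exists2 a, Delta D a & 0 < B x a.
  apply: contrapT => na; apply: nx => b /pos_rootsP[_ Cb].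
  apply: (ncone_le0 finD _ Cb) => a Da; rewrite leNgt; apply/negP => xa.
  by apply: na; exists a.
have as_ : a \in s by apply: sx => //; exact: simple_pos_root.
(* Since [(r_a x, b) = (x, r_a b)], the new list consists of the reflected entries of [s] with [a]
   removed: [a] itself now pairs negatively. *)
have [||w wP] := IH (map (cact (r a)) (rem a s)) (cact (r a) x).
- by rewrite size_map size_rem // (leq_trans _ sn) // ltn_predL; case: (s) as_.
- move=> b pb rxb.
  have xrb : 0 < B x (cact (r a) b) by rewrite -(bform_cact (r a)) cact_reflK.
  have ba : b <> a.
    move=> ba; move: xrb; rewrite ba cact_refl_self // linearNr oppr_gt0.
    by rewrite ltNge ltW.
  have prb := cact_refl_pos_root Da pb ba.
  apply/mapP; exists (cact (r a) b); last by rewrite cact_reflK.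
  apply: rem_mem; last exact: sx.
  apply/eqP => rba.
  apply: (pos_rootsN pb); rewrite -(cact_reflK Da b) rba cact_refl_self // opprK.
  exact: ncone_mem.
- by exists (w * r a)%g => b; rewrite cactM; exact: wP.
Qed.

(** * The Tits cone and its dual *)

Lemma cone_ncone (x : X D) : cone x <-> C (val x).
Proof.
split=> [[/(PLC_ncone finD)//|->]|Cx]; first exact: ncone0.
have [x0|x0] := eqVneq (val x) 0; first by right; exact: val_inj.
by left; exact: ncone_PLC.
Qed.

Definition toX (a : V) : X D := insubd 0 a.

Lemma val_toX a : Delta D a -> val (toX a) = a.
Proof.
move=> Da; rewrite val_insubd unfold_in ifT //.
by apply/mem_set => E [_]; exact.
Qed.

Lemma conic_cone s (x : X D) :
  {subset s <= fset_set (Delta D)} -> conic (map toX s) x -> cone x.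
Proof.
move=> sD; rewrite cone_ncone.
elim: s sD x => [|a s IH] sD x; first by move=> /= ->; exact: ncone0.
have /(mem_fset_set finD) Da : a \in fset_set (Delta D).
  by apply: sD; exact: mem_head.
move=> [t t0 /IH Cx]; rewrite -(subrK (t *: toX a) x) addrC linearP.
apply: nconeD; last by apply: Cx => b bs; apply: sD; rewrite in_cons bs orbT.
by apply: nconeZ => //=; rewrite val_toX //; exact: ncone_mem.
Qed.

Lemma dual_coneP (f : {scalar X D}) :
  dual_cone f <-> forall a, Delta D a -> 0 <= f (toX a).
Proof.
split=> [fP a Da|fD x /cone_ncone[l l0 xE]].
  by apply: fP; apply/cone_ncone; rewrite val_toX //; exact: ncone_mem.
have -> : x = \sum_(a <- fset_set (Delta D)) l a *: toX a.
  apply: val_inj; rewrite xE linear_sum; apply: eq_big_seq => a.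
  by move=> /(mem_fset_set finD) Da; rewrite linearZ /= val_toX.
rewrite linear_sum big_seq_cond sumr_ge0 // => a.
move=> /andP[/(mem_fset_set finD) Da _].
by rewrite linearZ mulr_ge0 ?l0 ?fD.
Qed.

Lemma bidual_cone (x : X D) : (forall f, dual_cone f -> 0 <= f x) -> cone x.
Proof.
move=> fx; apply: contrapT => nx.
have [|f [fD]] := @farkas _ _ (map toX (fset_set (Delta D))) x.
  by move=> xs; apply: nx; exact: conic_cone xs.
apply/negP; rewrite -leNgt; apply/fx/dual_coneP => a /(mem_fset_set finD) aD.
by apply: fD; exact: map_f.
Qed.

(** Pairing [x] with an element of [w P*] amounts to pairing [w^-1 x] with an element of [P*], so
    the bidual cone theorem applies along the orbit. *)
Lemma tits_dualP (x : X D) : tits_dual W x <-> forall w : W, cone (actX w x).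
Proof.
split=> [xU w|xw f [w _ [g gP <-]]].
  apply: bidual_cone => f fP.
  have := xU (dual_act w^-1%g f); rewrite /dual_act /= /dual_act_fun invgK.
  by apply; exists w^-1%g => //; exists f.
by rewrite /dual_act /= /dual_act_fun; apply: gP; exact: xw.
Qed.

End Roots.

Theorem proposition4p22 (R : realType) (V : lmodType R) (D : coxeterDatum V)
    (W : coxeterGroup D) :
  finite_set (Delta D) ->
  imaginary_cone W =
  [set x : X D | exists (w : W) (v : X D),
    [/\ cone v, forall a : V, pos_roots W a -> bform D (val v) a <= 0
      & x = actX w v]].
Proof.
move=> finD; apply/seteqP; split=> [x [xU xfin]|_ [w [v [vP vneg ->]]]] /=.
  have [w wP] := antidominant_conjugate finD xfin.
  exists w^-1%g, (actX w x); split=> //; first exact: (tits_dualP W finD x).1.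
  by apply: val_inj; rewrite /= cactK.
have wvP u : cone (actX u v).
  apply/(cone_ncone finD)/(cact_antidominant_ncone finD) => [|a Da].
    exact/(cone_ncone finD).
  by apply: vneg; exact: simple_pos_root.
split.
  apply/(tits_dualP W finD) => u.
  have -> : actX u (actX w v) = actX (u * w)%g v.
    by apply: val_inj; rewrite /= cactM.
  exact: wvP.
(* As [(w v, b) = (v, w^-1 b)], a positive value forces [w^-1] to invert [b]. *)
apply: sub_finite_set (finite_inversions finD w^-1%g) => b [pb vb]; split=> // pwb.
by apply: vb; rewrite -(cactVK w b) bform_cact; exact: vneg.
Qed.
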